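(* Let $\epsilon>0$, $\delta\ge0$, $\beta\in[0,1)$, $\alpha\ge0$. Suppose $\mathcal{M}$ is an $(\epsilon,\delta)$-high-sensitivity constraint private LP solver which, on every input, with probability at least $1-\beta$ outputs an $\alpha$-feasible solution that satisfies all public constraints. Then $\alpha\ge c(2\epsilon,\delta(1+e^\epsilon),\beta)$.
   Context: For $\epsilon>0$, $\delta\ge0$, $\beta\in[0,1)$ define $c(\epsilon,\delta,\beta)=\frac12-\frac{e^\epsilon+\delta}{2(1+e^\epsilon)(1-\beta)}$. The solver's inputs are feasibility linear programs in variables $x\in\mathbb{R}^n$ consisting of public (data-independent) constraints, which must be satisfied exactly, together with private constraints given by a number $m$, a matrix $A\in\mathbb{R}^{m\times n}$ and a vector $b\in\mathbb{R}^m$ (linear equality or inequality constraints $A_ix=b_i$ or $A_ix\le b_i$). A point $x$ is $\alpha$-feasible if each private inequality holds up to additive $\alpha$ ($A_ix\le b_i+\alpha$) and each private equality holds up to $|A_ix-b_i|\le\alpha$. The solver is $(\epsilon,\delta)$-high-sensitivity constraint private if, for the same public constraints, for all $A,A'$ such that $A'$ equals $A$ with one additional row appended and $b'$ equals $b$ with one additional entry, and all sets $S$, $\Pr[\mathcal{M}(m,b,A)\in S]\le e^\epsilon\Pr[\mathcal{M}(m+1,b',A')\in S]+\delta$. *)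

(* Defs.v *)
From HB Require Import structures.
From mathcomp Require Import all_boot all_order all_algebra.
From mathcomp Require Import all_classical all_reals all_analysis.
Set Implicit Arguments.
Unset Strict Implicit.
Unset Printing Implicit Defensive.
Import Order.TTheory GRing.Theory Num.Theory.
Import numFieldNormedType.Exports.
Local Open Scope classical_set_scope.
Local Open Scope ring_scope.

Definition c_bound (R : realType) (eps delta beta : R) : R :=
  1 / 2 - (expR eps + delta) / (2 * (1 + expR eps) * (1 - beta)).

(* Row i stands for lhs_i x = rhs_i when is_eq i 0 is true, and for
   lhs_i x <= rhs_i when it is false. *)
Record constraints (R : realType) (n : nat) := Constraints {
  nb_rows : nat;
  lhs : 'M[R]_(nb_rows, n);
  rhs : 'cV[R]_nb_rows;
  is_eq : 'cV[bool]_nb_rows }.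

Definition append_row (R : realType) (n : nat) (C : constraints R n)
    (a : 'rV[R]_n) (b : R) (e : bool) : constraints R n :=
  Constraints (col_mx (lhs C) a) (col_mx (rhs C) (const_mx b : 'cV_1))
              (col_mx (is_eq C) (const_mx e : 'cV_1)).

Definition satisfies (R : realType) (n : nat) (C : constraints R n)
    (x : 'cV[R]_n) : Prop :=
  forall i : 'I_(nb_rows C),
    if is_eq C i 0 then (lhs C *m x) i 0 = rhs C i 0
    else (lhs C *m x) i 0 <= rhs C i 0.

Definition alpha_feasible (R : realType) (n : nat) (alpha : R)
    (C : constraints R n) (x : 'cV[R]_n) : Prop :=
  forall i : 'I_(nb_rows C),
    if is_eq C i 0 then `|(lhs C *m x) i 0 - rhs C i 0| <= alpha
    else (lhs C *m x) i 0 <= rhs C i 0 + alpha.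

Definition borel_cV (R : realType) (n : nat) :=
  g_sigma_algebraType (@open 'cV[R]_n).

(* A randomized LP solver maps the public constraints and the private
   constraints to the law of its output. *)
Definition lp_solver (R : realType) (n : nat) :=
  constraints R n -> constraints R n -> probability (borel_cV R n) R.

(* The inequality is required only from the smaller program to the larger one;
   the converse inequality is not part of the definition. *)
Definition high_sensitivity_constraint_private (R : realType) (n : nat)
    (eps delta : R) (M : lp_solver R n) : Prop :=
  forall (pub priv : constraints R n) (a : 'rV[R]_n) (b : R) (e : bool)
         (S : set (borel_cV R n)),
    measurable S ->
    (M pub priv S <=
     (expR eps)%:E * M pub (append_row priv a b e) S + delta%:E)%E.

(* The guarantee is only asked on feasible programs: on a program with
   contradictory public constraints no solver could meet it. *)
Definition accurate_solver (R : realType) (n : nat) (alpha beta : R)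
    (M : lp_solver R n) : Prop :=
  forall pub priv : constraints R n,
    (exists x : 'cV[R]_n, satisfies pub x /\ satisfies priv x) ->
    ((1 - beta)%:E <=
     M pub priv [set x : 'cV[R]_n | alpha_feasible alpha priv x /\
                                    satisfies pub x])%E.

(* Main.v *)
(* Take no public constraint and let the smaller program have no private row.
   Appending the row x_0 = 0 or the row x_0 = 1 gives two neighbours of it, so
   by accuracy and privacy the smaller program's output violates either row by
   more than alpha with probability at most e^eps beta + delta.  If
   alpha < 1/2 every point violates one of the rows by more than alpha, whence
   1 <= 2 (e^eps beta + delta).  As 2 e^eps <= 1 + e^(2 eps) and
   2 <= 1 + e^eps, this forces c(2 eps, delta (1 + e^eps), beta) <= 0. *)
Require Import Defs.
From HB Require Import structures.
From mathcomp Require Import all_boot all_order all_algebra.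
From mathcomp Require Import all_classical all_reals all_analysis.
From mathcomp Require Import ring lra.
Set Implicit Arguments.
Unset Strict Implicit.
Unset Printing Implicit Defensive.
Import Order.TTheory GRing.Theory Num.Theory.
Import numFieldNormedType.Exports.
Local Open Scope classical_set_scope.
Local Open Scope ring_scope.

Definition no_constraints (R : realType) (n : nat) : constraints R n :=
  @Constraints R n 0 0 0 (const_mx false).

Definition coord_eq (R : realType) (n : nat) (i : 'I_n) (b : R) :
  constraints R n := append_row (no_constraints R n) (delta_mx 0 i) b true.

Definition coord_far (R : realType) (n : nat) (alpha : R) (i : 'I_n) (b : R) :
  set (borel_cV R n) := [set x : 'cV[R]_n | alpha < `|x i 0 - b|].

Lemma satisfies_no_constraints (R : realType) (n : nat) (x : 'cV[R]_n) :
  satisfies (no_constraints R n) x.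
Proof. by case. Qed.

Lemma coord_eq_row (R : realType) (n : nat) (j : 'I_n) (b : R)
    (x : 'cV[R]_n) (i : 'I_(nb_rows (coord_eq j b))) :
  [/\ is_eq (coord_eq j b) i 0 = true,
      (lhs (coord_eq j b) *m x) i 0 = x j 0 & rhs (coord_eq j b) i 0 = b].
Proof.
(* There are [0 + 1] rows, so every index is that of the appended row. *)
have -> : i = rshift 0 (0 : 'I_1) by apply/val_inj; case: i => [[|k]].
split; rewrite /= ?col_mxEd ?mxE //.
rewrite (bigD1 j) //= col_mxEd !mxE !eqxx mul1r big1 ?addr0 // => k kj.
by rewrite col_mxEd !mxE (negbTE kj) mul0r.
Qed.

Lemma satisfies_coord_eq (R : realType) (n : nat) (j : 'I_n) (b : R)
    (x : 'cV[R]_n) : x j 0 = b -> satisfies (coord_eq j b) x.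
Proof. by move=> xb i; have [-> -> ->] := coord_eq_row x i. Qed.

Lemma alpha_feasible_coord_eq (R : realType) (n : nat) (alpha : R) (j : 'I_n)
    (b : R) (x : 'cV[R]_n) :
  alpha_feasible alpha (coord_eq j b) x <-> `|x j 0 - b| <= alpha.
Proof.
split=> [|xb i].
  pose i : 'I_(nb_rows (coord_eq j b)) := rshift 0 (0 : 'I_1).
  by move=> /(_ i); have [-> -> ->] := coord_eq_row x i.
by have [-> -> ->] := coord_eq_row x i.
Qed.

(** The set is open, being the preimage of an open ray under a continuous map, and open sets
    generate the sigma-algebra. *)
Lemma measurable_coord_far (R : realType) (n : nat) (alpha : R) (i : 'I_n)
    (b : R) : measurable (coord_far alpha i b).
Proof.
apply: sub_sigma_algebra.
apply: (@open_comp _ _ (fun x : 'cV[R]_n => `|x i 0 - b|) [set y | alpha < y]).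
  move=> x _; apply: (@continuous_comp _ _ _ (fun x : 'cV[R]_n => x i 0 - b)
    (fun y : R => `|y|)); last exact: norm_continuous.
  apply: (@cvgB _ _ _ (nbhs x) _ (fun z : 'cV[R]_n => z i 0) (fun=> b));
    last exact: cvg_cst.
  exact: (@coord_continuous R n 1 i 0 x).
exact: open_gt.
Qed.

Lemma private_coord_far (R : realType) (n : nat) (eps delta beta alpha : R)
    (M : lp_solver R n) (i : 'I_n) (b : R) :
  high_sensitivity_constraint_private eps delta M ->
  accurate_solver alpha beta M ->
  (M (no_constraints R n) (no_constraints R n) (coord_far alpha i b)
   <= (expR eps * beta + delta)%:E)%E.
Proof.
move=> private accurate; have mF := measurable_coord_far alpha i b.
apply: le_trans (private _ _ (delta_mx 0 i) b true _ mF) _.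
rewrite -/(coord_eq i b) EFinD EFinM leeD2r // lee_wpmul2l ?lee_fin ?expR_ge0 //.
have := accurate (no_constraints R n) (coord_eq i b).
(* With no public constraint, the success event for the one-row program is exactly the complement of
   [coord_far], so accuracy bounds [coord_far] by [beta] there. *)
set A := (X in M _ _ X); have -> : A = ~` coord_far alpha i b.
  apply/seteqP; split=> x /=.
    by case=> /alpha_feasible_coord_eq xb _; apply/negP; rewrite -leNgt.
  move=> /negP; rewrite -leNgt => xb; split.
    exact/alpha_feasible_coord_eq.
  exact: satisfies_no_constraints.
rewrite probability_setC // => accurate_b.
have {accurate_b} : ((1 - beta)%:E <= 1 -
    M (no_constraints R n) (coord_eq i b) (coord_far alpha i b))%E.
  (* Accuracy applies only to feasible programs; the constant vector [b] is a solution. *)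
  apply: accurate_b; exists (const_mx b); split.
    exact: satisfies_no_constraints.
  by apply: satisfies_coord_eq; rewrite mxE.
rewrite -(fineK (fin_num_measure (M _ _) _ mF)) -EFinB !lee_fin; lra.
Qed.

Lemma private_error_ge (R : realType) (n : nat) (eps delta beta alpha : R)
    (M : lp_solver R n) :
  (0 < n)%N -> alpha < 1 / 2 ->
  high_sensitivity_constraint_private eps delta M ->
  accurate_solver alpha beta M ->
  1 <= 2 * (expR eps * beta + delta).
Proof.
move=> n_gt0 alpha_lt private accurate; pose i := Ordinal n_gt0.
pose P := M (no_constraints R n) (no_constraints R n).
have cover : coord_far alpha i 0 `|` coord_far alpha i 1 = setT.
  apply/seteqP; split=> // x _ /=.
  have [|far0] := ltP alpha `|(x : 'cV[R]_n) i 0 - 0|; [by left | right].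
  (* The triangle inequality through the coordinate of [x]: its distances to 0 and 1 sum to at least
     1, so they cannot both be at most [alpha < 1 / 2]. *)
  have := ler_distD ((x : 'cV[R]_n) i 0) 0 (1 : R).
  rewrite /coord_far /= sub0r normrN normr1 -[0 - _]opprB normrN; lra.
rewrite -lee_fin mulr_natl mulr2n EFinD -(probability_setT P) -cover.
apply: le_trans (measureU2 _ _ _) _; try exact: measurable_coord_far.
by apply: leeD; apply: private_coord_far private accurate.
Qed.

Theorem theorem38 (R : realType) (n : nat) (eps delta beta alpha : R)
    (M : lp_solver R n) :
  (0 < n)%N ->
  0 < eps -> 0 <= delta -> 0 <= beta -> beta < 1 -> 0 <= alpha ->
  high_sensitivity_constraint_private eps delta M ->
  accurate_solver alpha beta M ->
  alpha >= c_bound (2 * eps) (delta * (1 + expR eps)) beta.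
Proof.
move=> n_gt0 eps_gt0 delta_ge0 beta_ge0 beta_lt1 alpha_ge0 private accurate.
have E_gt1 : 1 < expR eps by rewrite expR_gt1.
have -> : 2 * eps = eps + eps by ring.
rewrite /c_bound expRD; set E := expR eps in E_gt1 *.
have den_gt0 : 0 < 2 * (1 + E * E) * (1 - beta).
  by rewrite !mulr_gt0 ?subr_gt0 //; nra.
have [alpha_ge|alpha_lt] := leP (1 / 2) alpha.
  (* The bound never exceeds 1/2, since the subtracted fraction is nonnegative. *)
  apply: le_trans alpha_ge; rewrite gerBl; apply: divr_ge0; last exact: ltW.
  have := mulr_ge0 delta_ge0 (ltW (lt_trans ltr01 E_gt1)); nra.
have := private_error_ge n_gt0 alpha_lt private accurate; rewrite -/E => err.
apply: le_trans alpha_ge0; rewrite subr_le0 ler_pdivlMr //.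
(* The goal amounts to [1 <= beta * (1 + E * E) + delta * (1 + E)]; its right side exceeds that of
   [err] by exactly the sum of this term and the next. *)
have : 0 <= beta * (E - 1) ^+ 2 by rewrite mulr_ge0 ?sqr_ge0.
have : 0 <= delta * (E - 1) by rewrite mulr_ge0 // subr_ge0 ltW.
lra.
Qed.
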